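(* Let $(M,d)$ be the countable metric space defined in the context. Then $M$ does not embed bi-Lipschitz with distortion strictly less than $2$ into any space $L_1(\mu)$ ($\mu$ a measure).
   Context: $\mathbb N=\{1,2,3,\dots\}$. The metric space $(M,d)$: let $F=\{A\subset\mathbb N: 1\le |A|<\infty\}$ be the set of all finite nonempty subsets of $\mathbb N$, and let $M=\{\emptyset\}\cup\mathbb N\cup F$ (the three pieces are regarded as pairwise disjoint). Make $M$ into a graph by putting an edge between $\emptyset$ and every $n\in\mathbb N$, and an edge between $n\in\mathbb N$ and $A\in F$ exactly when $n\in A$; there are no other edges. The metric $d$ is the shortest path metric of this graph. Explicitly, for $n\ne m$ in $\mathbb N$ and $A\neq B$ in $F$: $d(\emptyset,n)=1$; $d(n,m)=2$; $d(n,A)=1$ if $n\in A$ and $d(n,A)=3$ if $n\notin A$; $d(\emptyset,A)=2$; $d(A,B)=2$ if $A\cap B\ne\emptyset$ and $d(A,B)=4$ if $A\cap B=\emptyset$. A map $f:(M,d)\to(N,\rho)$ between metric spaces is bi-Lipschitz if there are constants $C_1,C_2>0$ with $C_1d(x,y)\le\rho(f(x),f(y))\le C_2d(x,y)$ for all $x,y\in M$; its distortion $\mathrm{dist}(f)$ is the infimum of $C_2/C_1$ over all such pairs of constants. $M$ embeds bi-Lipschitz into $N$ with distortion $D$ if there is a bi-Lipschitz $f:M\to N$ with $\mathrm{dist}(f)=D$. *)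

(* Defs.v *)
From HB Require Import structures.
From mathcomp Require Import all_boot all_order all_algebra finmap.
From mathcomp Require Import all_classical all_reals all_analysis.
(* all_analysis does not export the measurable structure of the extended reals *)
From mathcomp Require Import measurable_realfun.

Set Implicit Arguments.
Unset Strict Implicit.
Unset Printing Implicit Defensive.

Import Order.TTheory GRing.Theory Num.Theory.
Import numFieldNormedType.Exports.

Local Open Scope classical_set_scope.
Local Open Scope ring_scope.

Section ShortestPath.
Variables (V : Type) (e : rel V).

Definition walk (n : nat) (x y : V) : Prop :=
  exists p : seq V, [/\ path e x p, last x p = y & size p = n].

Hypothesis e_sym : symmetric e.
Hypothesis e_conn : forall x y, exists n, `[< walk n x y >].

Definition path_dist (x y : V) : nat := ex_minn (e_conn x y).

Lemma path_distP x y : walk (path_dist x y) x y.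
Proof. by rewrite /path_dist; case: ex_minnP => n /asboolP. Qed.

Lemma path_dist_le n x y : walk n x y -> (path_dist x y <= n)%N.
Proof.
by move=> w; rewrite /path_dist; case: ex_minnP => m _; apply; exact/asboolP.
Qed.

Lemma walk_sym n x y : walk n x y -> walk n y x.
Proof.
case=> p [xp <- <-]; exists (rev (belast x p)); split.
- rewrite rev_path (@eq_path _ _ e)// => a b; exact: e_sym.
- by case: p xp => //= a p _; rewrite rev_cons last_rcons.
- by rewrite size_rev size_belast.
Qed.

Lemma walk_cat n m x y z : walk n x y -> walk m y z -> walk (n + m) x z.
Proof.
case=> p [xp <- <-] [q [yq <- <-]]; exists (p ++ q).
by rewrite cat_path last_cat size_cat xp.
Qed.

Lemma path_distxx x : path_dist x x = 0%N.
Proof. by apply/eqP; rewrite -leqn0; apply: path_dist_le; exists [::]. Qed.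

Lemma path_dist0 x y : path_dist x y = 0%N -> x = y.
Proof.
move=> d0; have := path_distP x y; rewrite d0.
by move=> [p [_ + /size0nil p0]]; rewrite p0.
Qed.

Lemma path_distC x y : path_dist x y = path_dist y x.
Proof.
by apply/eqP; rewrite eqn_leq; apply/andP; split; apply: path_dist_le;
  apply: walk_sym; exact: path_distP.
Qed.

Lemma path_dist_triangle y x z :
  (path_dist x z <= path_dist x y + path_dist y z)%N.
Proof. by apply/path_dist_le/walk_cat; exact: path_distP. Qed.

End ShortestPath.

Definition posnat : Type := {n : nat | (0 < n)%N}.
HB.instance Definition _ := Countable.on posnat.

Definition finsets : Type := {A : {fset posnat} | (0 < #|` A|)%N}.
HB.instance Definition _ := Countable.on finsets.

Inductive vertex : Type :=
| Root
| Pt of posnat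
| Fin of finsets.

Definition vertex_code (x : vertex) : unit + posnat + finsets :=
  match x with
  | Root => inl (inl tt)
  | Pt n => inl (inr n)
  | Fin A => inr A
  end.

Definition vertex_decode (u : unit + posnat + finsets) : vertex :=
  match u with
  | inl (inl _) => Root
  | inl (inr n) => Pt n
  | inr A => Fin A
  end.

Lemma vertex_codeK : cancel vertex_code vertex_decode.
Proof. by case. Qed.

HB.instance Definition _ := Countable.copy vertex (can_type vertex_codeK).

Definition edge (x y : vertex) : bool :=
  match x, y with
  | Root, Pt _ | Pt _, Root => true
  | Pt n, Fin A | Fin A, Pt n => n \in val A
  | _, _ => false
  end.

Lemma edge_sym : symmetric edge.
Proof. by case=> [|n|A] [|m|B]. Qed.

Lemma finsets_neq0 (A : finsets) : exists n, n \in val A.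
Proof. by have := valP A; rewrite cardfs_gt0 => /fset0Pn. Qed.

Lemma edge_connected x y : exists n, `[< walk edge n x y >].
Proof.
have rooted z : exists n, walk edge n Root z.
  case: z => [|n|A]; first by exists 0%N, [::].
    by exists 1%N, [:: Pt n].
  by have [n nA] := finsets_neq0 A; exists 2%N, [:: Pt n; Fin A]; rewrite /= nA.
have [n xn] := rooted x; have [m ym] := rooted y.
by exists (n + m)%N; apply/asboolP; exact: walk_cat (walk_sym edge_sym xn) ym.
Qed.

Definition vertex_dist : vertex -> vertex -> nat := path_dist edge_connected.

(* The scalar field R is a parameter of the type so that it can be inferred
   from a space by canonical structure resolution. *)
Definition Mspace (R : realType) : Type := vertex.
HB.instance Definition _ (R : realType) := Countable.on (Mspace R).

Section MspaceMetric.
Variable R : realType.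

Let dist (x y : Mspace R) : R := (vertex_dist x y)%:R.

Let distxx x : dist x x = 0.
Proof. by rewrite /dist /vertex_dist path_distxx. Qed.

Let dist_eq0 x y : dist x y = 0 -> x = y.
Proof. by move=> /eqP; rewrite pnatr_eq0 => /eqP; exact: path_dist0. Qed.

Let distC x y : dist x y = dist y x.
Proof. by rewrite /dist /vertex_dist (path_distC edge_sym). Qed.

Let dist_triangle y x z : dist x z <= dist x y + dist y z.
Proof. by rewrite /dist -natrD ler_nat; exact: path_dist_triangle. Qed.

HB.instance Definition _ := @isMetric.Build R (Mspace R) dist
  distxx dist_eq0 distC dist_triangle.

End MspaceMetric.

Lemma mdist_Mspace (R : realType) (x y : Mspace R) :
  mdist x y = (vertex_dist x y)%:R :> R.
Proof. by []. Qed.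

Section ExplicitDistance.
Implicit Types (n m : posnat) (A B : finsets).
Local Notation dM := vertex_dist.
Local Open Scope nat_scope.

Let wit k x y p : path edge x p -> last x p = y -> size p = k -> dM x y <= k.
Proof. by move=> xp py pk; apply: path_dist_le; exists p. Qed.

Lemma vertex_dist_Root_Pt n : dM Root (Pt n) = 1.
Proof.
apply/eqP; rewrite eqn_leq (@wit _ _ _ [:: Pt n])//= lt0n.
by apply/eqP => d0; have := path_dist0 d0.
Qed.

Lemma vertex_dist_Root_Fin A : dM Root (Fin A) = 2.
Proof.
have [n nA] := finsets_neq0 A.
apply/eqP; rewrite eqn_leq (@wit _ _ _ [:: Pt n; Fin A])//=; last by rewrite nA.
have := path_distP edge_connected Root (Fin A); rewrite -/dM.
by case=> -[|a [|b p]]//= [+ + <-]//; move=> + ay; rewrite {}ay/=.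
Qed.

Lemma vertex_dist_Pt_Pt n m : n != m -> dM (Pt n) (Pt m) = 2.
Proof.
move=> nm; apply/eqP; rewrite eqn_leq (@wit _ _ _ [:: Root; Pt m])//=.
have := path_distP edge_connected (Pt n) (Pt m); rewrite -/dM.
case=> -[|a [|b p]]//= [+ + <-]//; last by move=> + ay; rewrite {}ay/=.
by move=> _ [nm']; rewrite nm' eqxx in nm.
Qed.

Lemma vertex_dist_Pt_Fin n A :
  dM (Pt n) (Fin A) = if n \in val A then 1 else 3.
Proof.
case: ifPn => nA.
  apply/eqP; rewrite eqn_leq (@wit _ _ _ [:: Fin A])//= ?nA// lt0n.
  by apply/eqP => d0; have := path_dist0 d0.
have [m mA] := finsets_neq0 A.
apply/eqP; rewrite eqn_leq (@wit _ _ _ [:: Root; Pt m; Fin A])//= ?mA//.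
have := path_distP edge_connected (Pt n) (Fin A); rewrite -/dM.
case=> -[|a [|b [|c p]]]//= [+ + <-]//.
  by move=> + ay; rewrite {}ay/= (negbTE nA).
by move=> + ay; rewrite {}ay/=; case: a => [|k|B]/=; rewrite ?andbF.
Qed.

Lemma vertex_dist_Fin_Fin A B : A != B ->
  dM (Fin A) (Fin B) = if (val A `&` val B)%fset != fset0 then 2 else 4.
Proof.
move=> AB; case: ifPn => [/fset0Pn[k]|/negPn/eqP AB0].
  rewrite in_fsetI => /andP[kA kB].
  apply/eqP; rewrite eqn_leq (@wit _ _ _ [:: Pt k; Fin B])//= ?kA ?kB//.
  have := path_distP edge_connected (Fin A) (Fin B); rewrite -/dM.
  case=> -[|a [|b p]]//= [+ + <-]//; last by move=> + ay; rewrite {}ay/=.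
  by move=> _ [AB']; rewrite AB' eqxx in AB.
have [n nA] := finsets_neq0 A; have [m mB] := finsets_neq0 B.
apply/eqP; rewrite eqn_leq.
rewrite (@wit _ _ _ [:: Pt n; Root; Pt m; Fin B])//= ?nA ?mB//.
have := path_distP edge_connected (Fin A) (Fin B); rewrite -/dM.
case=> -[|a [|b [|c [|e p]]]]//= [+ + <-]//.
- by move=> _ [AB']; rewrite AB' eqxx in AB.
- by move=> + ay; rewrite {}ay/=.
- move=> + ay; rewrite {}ay/=; case: a => //= k; rewrite andbT => /andP[kA kB].
  have : k \in (val A `&` val B)%fset by rewrite in_fsetI kA.
  by rewrite AB0 in_fset0.
- move=> + ay; rewrite {}ay/=.
  by case: a => [|k|C] /=; case: b => [|l|E] /=; rewrite ?andbF.
Qed.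

End ExplicitDistance.

(* Elements of LspaceType are a.e.-equality classes; the coercion to T -> R picks
   a representative, on which the Lp-norm does not depend. *)
Section LspaceMetric.
Context d (T : measurableType d) (R : realType).
Variables (mu : {measure set T -> \bar R}) (p : \bar R) (p1 : (1 <= p)%E).
Local Notation Lp := (LspaceType mu p1).
Implicit Types f g h : Lp.

Let diff f g : T -> R := (f : T -> R) \- (g : T -> R).

Let dist f g : R := fine 'N[mu]_p[EFin \o diff f g]%E.

Let mf f : measurable_fun [set: T] (f : T -> R).
Proof.
exact: (measurable_funPT (repr (f : {mfun_ mu, T >-> measurableTypeR R}))).
Qed.

Let mdiff f g : measurable_fun [set: T] (EFin \o diff f g).
Proof. by apply/measurable_EFinP; exact: measurable_funB. Qed.

Let dist_fin f g : (dist f g)%:E = 'N[mu]_p[EFin \o diff f g]%E.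
Proof.
rewrite fineK// ge0_fin_numE ?Lnorm_ge0//.
have mNg : measurable_fun [set: T] (\- (g : T -> R)) by exact: measurableT_comp.
apply: le_lt_trans (eminkowski mu (mf f) mNg p1) _.
apply: lte_add_pinfty; first exact: Lebesgue_finite.
have -> : EFin \o (\- (g : T -> R))%R = (\- (EFin \o (g : T -> R)))%E.
  by apply/funext => x.
by rewrite oppe_Lnorm; exact: Lebesgue_finite.
Qed.

Let distxx f : dist f f = 0.
Proof.
rewrite /dist (_ : _ \o _ = cst 0%E) ?Lnorm0//.
  by rewrite gt_eqF// (lt_le_trans _ p1).
by apply/funext => x /=; rewrite /diff/= subrr.
Qed.

Let dist_eq0 f g : dist f g = 0 -> f = g.
Proof.
move=> d0.
have N0 : 'N[mu]_p[EFin \o diff f g]%E = 0%E by rewrite -dist_fin d0.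
have ae0 := Lnorm_eq0_eq0 (mdiff f g) (lt_le_trans lte01 p1) N0.
have fg : (f : T -> R) = g %[ae mu].
  apply: filterS ae0 => x /(_ I) [/eqP]; rewrite subr_eq0 => /eqP fgx _.
  exact: fgx.
have fgE : (f : {mfun_ mu, T >-> measurableTypeR R}) = g.
  rewrite -[LHS]reprK -[RHS]reprK; apply/eqmodP; exact/asboolP.
case: f g fgE {d0 N0 ae0 fg} => f [[cf]] [g [[cg]]] /= fgE.
rewrite fgE in cf *; congr LebesgueSpace.Pack.
congr LebesgueSpace.Class.
by congr isFinLebesgue.Axioms_; exact: Prop_irrelevance.
Qed.

Let distC f g : dist f g = dist g f.
Proof.
rewrite /dist -[in RHS]oppe_Lnorm; congr (fine (Lnorm _ _ _)).
by apply/funext => x /=; rewrite /diff/= opprB.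
Qed.

Let dist_triangle g f h : dist f h <= dist f g + dist g h.
Proof.
rewrite -lee_fin EFinD !dist_fin.
have -> : diff f h = diff f g \+ diff g h.
  by apply/funext => x /=; rewrite /diff/= addrA subrK.
by apply: eminkowski => //; exact: measurable_funB.
Qed.

HB.instance Definition _ := gen_eqMixin Lp.
HB.instance Definition _ := gen_choiceMixin Lp.
HB.instance Definition _ := @isMetric.Build R Lp dist
  distxx dist_eq0 distC dist_triangle.

Lemma mdist_Lspace f g :
  mdist f g = fine 'N[mu]_p[EFin \o ((f : T -> R) \- (g : T -> R))%R]%E.
Proof. by []. Qed.

End LspaceMetric.

Lemma mdist_Lspace1 d (T : measurableType d) (R : realType)
    (mu : {measure set T -> \bar R}) (f g : LspaceType1 mu) :
  mdist f g = fine (\int[mu]_x `|(f : T -> R) x - (g : T -> R) x|%:E)%E.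
Proof. by rewrite mdist_Lspace Lnorm1. Qed.

Section Distortion.
Variables (R : realType) (X Y : metricType R) (f : X -> Y).

Definition bilipschitz_consts (C1 C2 : R) : Prop :=
  [/\ 0 < C1, 0 < C2 &
    forall x y, C1 * mdist x y <= mdist (f x) (f y) <= C2 * mdist x y].

Definition bilipschitz : Prop := exists C1 C2, bilipschitz_consts C1 C2.

Definition distortion : R :=
  inf [set C.2 / C.1 | C in [set C : R * R | bilipschitz_consts C.1 C.2]].

End Distortion.

Definition embeds_with_distortion (R : realType) (X Y : metricType R) (D : R) :
    Prop :=
  exists f : X -> Y, bilipschitz f /\ distortion f = D.

(* Main.v *)
(** The norm distance of [L_1(mu)] is of negative type: when [\sum_i c_i = 0],
    [\sum_(i, j) c_i c_j |a_i - a_j| <= 0] for reals, and one integrates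
    pointwise.  Let [f] embed [M] with constants [C1], [C2].  Choose [k]
    disjoint pairs of points of [N] and split each pair between two disjoint [k]-sets
    [A], [B]; for suitable choices,
    [\sum_(p, q) s_p s_q |f p - f q| >= - 4 k C2], where [s] is [1] on [A] and
    [-1] on [B].  Give weight [s_p] to each [p], and [-t], [t] to the vertices
    [A], [B].  The cross terms contribute at least [4 t k (3 C1 - C2)], since
    [p] in [A] is at distance [1] from [A] and [3] from [B], while the remaining
    terms are at least [- 8 t^2 C2 - 4 k C2].  With [k = t^2] and [t] large,
    negative type forces [C2 / C1 >= 3], so even distortion less than [3] is
    impossible. *)

Require Import Defs.
From mathcomp Require Import all_boot all_order all_algebra finmap.
From mathcomp Require Import all_classical all_reals all_analysis.
From mathcomp Require Import ring lra.

Import Order.TTheory GRing.Theory Num.Theory.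
Import numFieldNormedType.Exports.

Local Open Scope ring_scope.

(** For nonnegative entries, [Num.min (a i) (a j)] is the length of the intersection of [0, [a i]]
    and [0, [a j]], a Gram kernel. The induction on the number of positive entries writes the form
    as a sum of squares. *)
Lemma min_kernel_ge0 (R : realFieldType) (I : finType) (c a : I -> R) :
  (forall i, 0 <= a i) ->
  0 <= \sum_i \sum_j c i * c j * Num.min (a i) (a j).
Proof.
have [n] := ubnP #|[pred i | 0 < a i]|.
elim: n a => // n IHn a; rewrite ltnS => an a0.
have [i0 ai0|pa] := pickP [pred i | 0 < a i]; last first.
  rewrite big1// => i _; rewrite big1// => j _.
  have z k : a k = 0 by apply/eqP; rewrite eq_le a0 leNgt (negbT (pa k)).
  by rewrite !z minxx mulr0.
have [m /= m0 mP] :=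
  @Order.TotalTheory.arg_minP _ _ _ i0 [pred i | 0 < a i] a ai0.
(* Peel off the lowest positive layer: [b] has fewer positive entries. *)
pose b i := if 0 < a i then a i - a m else 0.
pose e i : R := (0 < a i)%R%:R.
have minE i j : Num.min (a i) (a j) = a m * (e i * e j) + Num.min (b i) (b j).
  rewrite /b /e; have := a0 i; have := a0 j; have := mP i; have := mP j.
  by have [ai|ai] := ltP 0 (a i); have [aj|aj] := ltP 0 (a j) => /=
    amj ami aj0 ai0'; try have {}amj := amj isT; try have {}ami := ami isT;
    case: leP => ?; case: leP => ?; lra.
have -> : \sum_i \sum_j c i * c j * Num.min (a i) (a j) =
    a m * (\sum_i c i * e i) ^+ 2 +
    \sum_i \sum_j c i * c j * Num.min (b i) (b j).
  rewrite expr2 mulr_suml mulr_sumr -big_split/=; apply: eq_bigr => i _.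
  rewrite !mulr_sumr -big_split/=; apply: eq_bigr => j _.
  by rewrite minE; ring.
apply: addr_ge0; first by rewrite mulr_ge0 ?sqr_ge0 ?a0.
apply: IHn => [|i].
  apply: leq_trans an; apply: proper_card; apply/properP; split.
    apply/fintype.subsetP => i; rewrite !inE /b; case: ifP => //.
    by rewrite ltxx.
  by exists m; rewrite !inE//= /b m0 subrr ltxx.
by rewrite /b; case: ifP => // ai; rewrite subr_ge0 mP.
Qed.

Definition negative_type (R : numDomainType) (V : Type) (rho : V -> V -> R) :=
  forall (I : finType) (c : I -> R) (x : I -> V), \sum_i c i = 0 ->
    \sum_i \sum_j c i * c j * rho (x i) (x j) <= 0.

(** A shift makes all points nonnegative and keeps differences. Then |a - b| = a + b - 2 min(a, b),
    and the terms a and b vanish because the weights sum to 0. *)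
Lemma dist_negative_type (R : realFieldType) :
  negative_type R R (fun a b => `|a - b|).
Proof.
move=> I c a c0; pose s := \sum_i `|a i|; pose b i := a i + s.
have b0 i : 0 <= b i.
  rewrite -lerBlDr sub0r lerNl (le_trans (ler_norm _))// normrN.
  by rewrite /s (bigD1 i)//= lerDl sumr_ge0.
have absE i j : `|a i - a j| = b i + b j - 2 * Num.min (b i) (b j).
  rewrite (_ : a i - a j = b i - b j); last by rewrite /b; ring.
  by case: leP => bij; [rewrite ler0_norm|rewrite gtr0_norm]; lra.
have -> : \sum_i \sum_j c i * c j * `|a i - a j| =
    (\sum_i c i * b i) * (\sum_j c j) + (\sum_i c i) * (\sum_j c j * b j) -
    2 * \sum_i \sum_j c i * c j * Num.min (b i) (b j).
  rewrite !mulr_suml mulr_sumr -big_split -sumrB/=; apply: eq_bigr => i _.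
  rewrite !mulr_sumr -big_split -sumrB/=; apply: eq_bigr => j _.
  by rewrite absE; ring.
rewrite c0 mulr0 mul0r !add0r oppr_le0 mulr_ge0//.
exact: min_kernel_ge0.
Qed.

Lemma Lspace1_negative_type (R : realType) (d : measure_display)
    (T : measurableType d) (mu : {measure set T -> \bar R}) :
  negative_type R (LspaceType1 mu) mdist.
Proof.
move=> I c f c0.
have intf (g h : LspaceType1 mu) :
    mu.-integrable setT (fun x => `|(g : T -> R) x - (h : T -> R) x|%:E)%E.
  have ig (u : LspaceType1 mu) : mu.-integrable setT (EFin \o (u : T -> R)).
    apply/Lfun1_integrable; rewrite inE/=; apply/andP; split; rewrite inE/=.
      exact: (measurable_funPT
        (repr (u : {mfun_ mu, T >-> measurableTypeR R}))).
    exact: Lebesgue_finite.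
  exact: integrable_abse (integrableB measurableT (ig g) (ig h)).
pose F i x := (\sum_j (c i * c j)%:E *
  `|(f i : T -> R) x - (f j : T -> R) x|%:E)%E.
have intF i : mu.-integrable setT (F i).
  by apply: integrable_sum => // j _; apply: integrableZl => //; exact: intf.
rewrite -lee_fin (_ : _%:E = \int[mu]_x \sum_i F i x)%E.
  rewrite -[leRHS](integral0 mu setT); apply: le_integral => //.
  - exact: integrable_sum.
  - exact: integrable0.
  move=> x _; rewrite /F.
  under eq_bigr do (under eq_bigr do rewrite -EFinM; rewrite sumEFin).
  by rewrite sumEFin lee_fin; exact: dist_negative_type.
rewrite integral_sum// -sumEFin; apply: eq_bigr => i _.
rewrite integral_sum//; last by move=> j; apply: integrableZl => //; exact: intf.
rewrite -sumEFin; apply: eq_bigr => j _.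
rewrite integralZl//.
(* [fine] would send an infinite integral to 0; integrability excludes this. *)
rewrite EFinM mdist_Lspace1 fineK//.
exact: integrable_fin_num (intf _ _).
Qed.

(** Off-diagonal terms average to 0 over random signs. The proof is greedy: each new sign makes its
    cross terms [u] with the earlier indices contribute a nonnegative amount. *)
Lemma sign_choice (R : realDomainType) (H : nat -> nat -> R) (k : nat) :
  exists s : nat -> bool, \sum_(i < k) H i i <=
    \sum_(i < k) \sum_(j < k) (-1) ^+ s i * (-1) ^+ s j * H i j.
Proof.
elim: k => [|k [s IHk]]; first by exists xpredT; rewrite !big_ord0.
pose u := \sum_(j < k) (-1) ^+ s j * (H k j + H j k).
pose s' i := if i == k then u < 0 else s i.
have s'u : 0 <= (-1) ^+ s' k * u.
  rewrite /s' eqxx; case: ltP => u0; rewrite ?expr1 ?expr0 ?mul1r//.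
  by rewrite mulN1r oppr_ge0 ltW.
have s'E (i : 'I_k) : s' i = s i by rewrite /s' ltn_eqF.
exists s'; have -> : \sum_(i < k.+1) \sum_(j < k.+1)
      (-1) ^+ s' i * (-1) ^+ s' j * H i j =
    \sum_(i < k) \sum_(j < k) (-1) ^+ s i * (-1) ^+ s j * H i j +
    (-1) ^+ s' k * u + H k k.
  under eq_bigr do rewrite big_ord_recr/=.
  rewrite big_ord_recr/= big_split/= addrA -!addrA; congr (_ + _).
    by apply: eq_bigr => i _; apply: eq_bigr => j _; rewrite !s'E.
  rewrite -mulrA signrMK addrA; congr (_ + _).
  rewrite -big_split mulr_sumr/=; apply: eq_bigr => i _.
  by rewrite !s'E; ring.
by rewrite big_ord_recr/= lerD2r ler_wpDr.
Qed.

Lemma negative_type_bilipschitz_ratio_ge3 (R : realType) (X : metricType R)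
    (f : Mspace R -> X) (C1 C2 : R) :
  negative_type R X mdist -> bilipschitz_consts f C1 C2 -> 3 * C1 <= C2.
Proof.
move=> negX [C10 C20 fC]; rewrite leNgt; apply/negP => C12.
(* With [k] = t^2 the negative-type sum will be at least 4 t^2 (t (3 C1 - C2) - 3 C2); this [t]
   makes it positive. *)
pose t := (Num.trunc (3 * C2 / (3 * C1 - C2))).+1.
have tC : 3 * C2 < t%:R * (3 * C1 - C2).
  by rewrite -ltr_pdivrMr ?subr_gt0// truncnS_gt.
pose k := (t ^ 2)%N.
pose pt (i : nat) (b : bool) : posnat := exist _ (choice.pickle (i, b)).+1 isT.
have pt_inj i j b e : pt i b = pt j e -> i = j /\ b = e.
  by case=> /(pcan_inj choice.pickleK)[].
(* For distinct [i] and [j], exchanging the two points of pair [i] negates [K i j]. A choice of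
   signs thus decides which point of each pair goes to which set. *)
pose K i j := \sum_(b : bool) \sum_(e : bool) (-1) ^+ b * (-1) ^+ e *
  mdist (f (Pt (pt i b))) (f (Pt (pt j e))).
have [s sK] := sign_choice R K k.
(* [A true] plays the role of the negative set, as [(-1) ^+ true = -1]. *)
pose x (i : nat) (b : bool) := pt i (s i (+) b).
pose A b : {fset posnat} := [fset n in [seq x i b | i <- iota 0 k]]%fset.
have mem_A i b e : (i < k)%N -> (x i e \in A b) = (e == b).
  move=> ik; rewrite in_fset; apply/mapP/eqP => [[j _]|->].
    by case/pt_inj => -> /addbI.
  by exists i; rewrite ?mem_iota.
have A_gt0 b : (0 < #|` A b|)%N.
  rewrite cardfs_gt0; apply/fset0Pn; exists (x 0%N b); rewrite mem_A//.
pose Y b : finsets := exist _ (A b) (A_gt0 b).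
pose y b := f (Fin (Y b)).
pose z i b := f (Pt (x i b)).
have yz_same i b : (i < k)%N -> mdist (y b) (z i b) <= C2.
  move=> ik; have /andP[_] := fC (Fin (Y b)) (Pt (x i b)).
  rewrite mdist_Mspace /vertex_dist (path_distC edge_sym) -/(vertex_dist _ _).
  by rewrite vertex_dist_Pt_Fin /= mem_A// eqxx mulr1.
have yz_diff i b : (i < k)%N -> 3 * C1 <= mdist (y (~~ b)) (z i b).
  move=> ik; have /andP[+ _] := fC (Fin (Y (~~ b))) (Pt (x i b)).
  rewrite mdist_Mspace /vertex_dist (path_distC edge_sym) -/(vertex_dist _ _).
  by rewrite vertex_dist_Pt_Fin /= mem_A//; case: b => /=; rewrite mulrC.
(* The diameter of [M] is 4, so every case of the distance formula gives this bound. *)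
have yy : mdist (y true) (y false) <= 4 * C2.
  have /andP[_ /le_trans] := fC (Fin (Y true)) (Fin (Y false)); apply.
  rewrite mulrC ler_wpM2r ?(ltW C20)// mdist_Mspace ler_nat.
  have [->|] := eqVneq (Y true) (Y false).
    by rewrite /vertex_dist path_distxx.
  by move=> YY; rewrite vertex_dist_Fin_Fin//; case: ifP.
have K_diag i : - (4 * C2) <= K i i.
  have : mdist (f (Pt (pt i true))) (f (Pt (pt i false))) <= 2 * C2.
    have /andP[_ /le_trans] := fC (Pt (pt i true)) (Pt (pt i false)); apply.
    rewrite mdist_Mspace vertex_dist_Pt_Pt ?(mulrC C2)//.
    by apply/eqP => /pt_inj[].
  rewrite /K !big_bool/= !mdistxx (metric_sym (f (Pt (pt i false)))).
  rewrite /= !expr1 !expr0; lra.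
pose I := (bool + 'I_k * bool)%type.
(* A set vertex has the sign opposite to its members, so distances to members count negatively and
   those to non-members positively. *)
pose c (u : I) : R :=
  match u with inl b => - (t%:R * (-1) ^+ b) | inr (_, e) => (-1) ^+ e end.
pose p (u : I) : X := match u with inl b => y b | inr (i, e) => z i e end.
have sum_pair (F : 'I_k * bool -> R) :
    \sum_q F q = \sum_(i < k) (F (i, true) + F (i, false)).
  transitivity (\sum_(i < k) \sum_b F (i, b)).
    by rewrite pair_bigA; apply: eq_bigr => -[].
  by apply: eq_bigr => i _; rewrite big_bool.
have c0 : \sum_u c u = 0.
  rewrite big_sumType/= big_bool sum_pair/= big1 => [|i _]; rewrite ?expr1 ?expr0.
    by ring.
  by rewrite addrC subrr.
have := negX I c p c0; apply/negP; rewrite -ltNge.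
pose W := \sum_(i < k) (mdist (y false) (z i true) + mdist (y true) (z i false) -
  mdist (y true) (z i true) - mdist (y false) (z i false)).
pose S := \sum_(i < k) \sum_(j < k) (-1) ^+ s i * (-1) ^+ s j * K i j.
(* Substituting [s i (+) b] for [b] in the sums defining [K] brings out the factor [(-1) ^+ s i]. *)
have SE : \sum_(q : 'I_k * bool) \sum_(r : 'I_k * bool)
    c (inr q) * c (inr r) * mdist (p (inr q)) (p (inr r)) = S.
  rewrite sum_pair; apply: eq_bigr => i _.
  rewrite !sum_pair -big_split/=; apply: eq_bigr => j _.
  rewrite /K /z /x !big_bool/=; case: (s i); case: (s j) => /=; ring.
have WE : \sum_b \sum_(q : 'I_k * bool)
    c (inl b) * c (inr q) * mdist (p (inl b)) (p (inr q)) = t%:R * W.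
  rewrite big_bool/= !sum_pair -big_split mulr_sumr/=.
  by apply: eq_bigr => i _; ring.
have WE' : \sum_(q : 'I_k * bool) \sum_b
    c (inr q) * c (inl b) * mdist (p (inr q)) (p (inl b)) = t%:R * W.
  rewrite exchange_big -WE; apply: eq_bigr => b _; apply: eq_bigr => q _.
  by rewrite metric_sym [c (inr q) * _]mulrC.
have -> : \sum_u \sum_v c u * c v * mdist (p u) (p v) =
    2 * (t%:R * W) - 2 * t%:R ^+ 2 * mdist (y true) (y false) + S.
  rewrite big_sumType/=.
  under eq_bigr do rewrite big_sumType.
  under [X in _ + X]eq_bigr do rewrite big_sumType.
  rewrite !big_split/= SE WE WE'.
  rewrite !big_bool/= !mdistxx (metric_sym (y false)).
  ring.
have W_ge : k%:R * (2 * (3 * C1 - C2)) <= W.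
  rewrite mulr_natl -[k in leLHS]card_ord -sumr_const; apply: ler_sum => i _.
  have := yz_same i true (ltn_ord i); have := yz_same i false (ltn_ord i).
  have := yz_diff i true (ltn_ord i); have := yz_diff i false (ltn_ord i).
  rewrite /=; lra.
have S_ge : - (k%:R * (4 * C2)) <= S.
  apply: le_trans sK; rewrite -mulrN [leLHS]mulr_natl -[k in leLHS]card_ord.
  by rewrite -sumr_const; apply: ler_sum => i _; exact: K_diag.
have t0 : 0 < t%:R :> R by rewrite ltr0n.
have tW : t%:R * (k%:R * (2 * (3 * C1 - C2))) <= t%:R * W by rewrite ler_pM2l.
have tyy : t%:R ^+ 2 * mdist (y true) (y false) <= t%:R ^+ 2 * (4 * C2).
  by rewrite ler_wpM2l// sqr_ge0.
have tt : t%:R ^+ 2 * (3 * C2) < t%:R ^+ 2 * (t%:R * (3 * C1 - C2)).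
  by rewrite ltr_pM2l ?exprn_gt0.
rewrite /k natrX in tW S_ge *; lra.
Qed.

Theorem corollary9 (R : realType) (d : measure_display) (T : measurableType d)
    (mu : {measure set T -> \bar R}) :
  ~ exists D : R, D < 2 /\
      embeds_with_distortion (Mspace R) (LspaceType1 mu) D.
Proof.
case=> D [D2 [f [[A1 [A2 fA]] distD]]].
(* An infimum below 2 yields one admissible pair of ratio below 2, as soon as the set of ratios is
   nonempty; [A1] and [A2] witness this. *)
move: D2; rewrite -distD => /inf_lt[|_ [[C1 C2]/= fC <-]].
  by exists (A2 / A1); exists (A1, A2).
have [C10 C20 _] := fC.
have := negative_type_bilipschitz_ratio_ge3 _ _ _ _ _
  (Lspace1_negative_type R d T mu) fC.
by rewrite ltr_pdivrMr// => C31; apply/negP; rewrite -leNgt; lra.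
Qed.
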